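(* There exists a universal constant $M > 0$ such that for every real $\kappa \ge 2$ and every real $0 < \delta < 1/2$ there exists a real polynomial $p_{\kappa,\delta}$ of degree at most $M \sqrt{\kappa}\, \log\frac{\kappa}{\delta}$ such that $$\left| p_{\kappa,\delta}(x) - x^{-1} \right| \le \frac{\delta}{\kappa} \qquad \text{for all real } x \text{ with } 1 \le x \le \kappa .$$
   Context: Here $\log$ is the natural logarithm. The degree bound, written $O(\sqrt{\kappa}\log\frac{\kappa}{\delta})$ in asymptotic notation, is understood with an absolute implied constant $M$, independent of $\kappa$ and $\delta$. *)

(* Defs.v *)
From mathcomp Require Import all_boot all_order all_algebra.

(* Main.v *)
(** With T the Chebyshev polynomial of degree n and l the affine map sending
    [1, kappa] onto [-1, 1], the polynomial 1 - T(l(x)) / T(l(0)) vanishes at 0;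
    its quotient by x approximates 1/x on [1, kappa] with error at most
    1 / T(l(0)).  Writing r for the square root of kappa,
    2 T(l(0)) >= ((r + 1) / (r - 1))^n >= exp(n / r), so that a degree n slightly
    above 2 r ln (kappa / delta) suffices. *)
Require Import Defs.
From mathcomp Require Import all_boot all_order all_algebra.
From mathcomp Require Import reals exp.
From mathcomp Require Import sequences zify ring lra.
Set Implicit Arguments.
Unset Strict Implicit.
Unset Printing Implicit Defensive.
Import Order.TTheory GRing.Theory Num.Theory.
Local Open Scope ring_scope.

(* [chebyshev x n = (T_n(x), U_{n-1}(x))]; taking [x] in an arbitrary ring
   covers both polynomials and their values. *)
Fixpoint chebyshev (A : comNzRingType) (x : A) (n : nat) : A * A :=
  if n is m.+1 then
    let: (t, u) := chebyshev x m in (x * t + (x ^+ 2 - 1) * u, t + x * u)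
  else (1, 0).

Lemma chebyshevS (A : comNzRingType) (x : A) (n : nat) :
  chebyshev x n.+1 =
  (x * (chebyshev x n).1 + (x ^+ 2 - 1) * (chebyshev x n).2,
   (chebyshev x n).1 + x * (chebyshev x n).2).
Proof. by rewrite /=; case: (chebyshev x n). Qed.

(** Each step of the recursion multiplies [t + s * u] by [x + s], where [s ^+ 2 = x ^+ 2 - 1];
    [x + s] has norm 1 and the norm is multiplicative. *)
Lemma chebyshev_pell (A : comNzRingType) (x : A) (n : nat) :
  (chebyshev x n).1 ^+ 2 - (x ^+ 2 - 1) * (chebyshev x n).2 ^+ 2 = 1.
Proof.
elim: n => [|n IHn]; first by rewrite /=; ring.
by rewrite chebyshevS -[RHS]IHn /=; ring.
Qed.

Lemma chebyshev_exp (A : comNzRingType) (x s : A) (n : nat) :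
  s ^+ 2 = x ^+ 2 - 1 ->
  (chebyshev x n).1 + s * (chebyshev x n).2 = (x + s) ^+ n.
Proof.
move=> hs; elim: n => [|n IHn]; first by rewrite /=; ring.
by rewrite chebyshevS [RHS]exprS -IHn /= -hs; ring.
Qed.

(** On this interval [x ^+ 2 - 1] is nonpositive, so the Pell identity writes 1 as the square of T
    plus a nonnegative term. *)
Lemma chebyshev_norm_le1 (R : realDomainType) (x : R) (n : nat) :
  -1 <= x <= 1 -> `|(chebyshev x n).1| <= 1.
Proof.
move=> hx; rewrite -(expr_le1 (_ : 0 < 2)%N) // real_normK ?num_real //.
rewrite -[leRHS](chebyshev_pell x n) lerDl oppr_ge0.
by apply: mulr_le0_ge0; [nra | exact: sqr_ge0].
Qed.

(** Adding the expansions for [s] and [- s] gives 2 T = (x + s)^n + (x - s)^n, whose last term is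
    nonnegative. *)
Lemma chebyshev_ge (R : realDomainType) (x s : R) (n : nat) :
  s ^+ 2 = x ^+ 2 - 1 -> s <= x -> (x + s) ^+ n <= 2 * (chebyshev x n).1.
Proof.
move=> hs sx; have hNs : (- s) ^+ 2 = x ^+ 2 - 1 by rewrite sqrrN.
have := exprn_ge0 n (_ : 0 <= x - s); rewrite subr_ge0 => /(_ sx).
by rewrite -(chebyshev_exp n hs) -(chebyshev_exp n hNs); lra.
Qed.

Lemma horner_chebyshev (R : comNzRingType) (l : {poly R}) (x : R) (n : nat) :
  ((chebyshev l n).1.[x] = (chebyshev l.[x] n).1) *
  ((chebyshev l n).2.[x] = (chebyshev l.[x] n).2).
Proof.
elim: n => [|n IHn]; first by rewrite /= !hornerE.
by rewrite !chebyshevS /= !hornerE !IHn.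
Qed.

Lemma size_polyM_le (R : nzRingType) (p q : {poly R}) (m n : nat) :
  (size p <= m.+1)%N -> (size q <= n)%N -> (size (p * q)%R <= m + n)%N.
Proof.
move=> hp hq; rewrite (leq_trans (size_polyMleq _ _)) //.
by move: hp hq; lia.
Qed.

Lemma size_chebyshev (R : comNzRingType) (l : {poly R}) (n : nat) :
  (size l <= 2)%N ->
  (size (chebyshev l n).1 <= n.+1)%N && (size (chebyshev l n).2 <= n)%N.
Proof.
move=> hl; elim: n => [|n /andP[ht hu]].
  by rewrite /= size_poly1 size_poly0.
have hl2 : (size (l ^+ 2 - 1)%R <= 3)%N.
  rewrite (leq_trans (size_polyD _ _)) // geq_max size_polyN size_poly1 andbT.
  by rewrite expr2; apply: (@size_polyM_le _ _ _ 1).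
rewrite chebyshevS /=; apply/andP; split.
  rewrite (leq_trans (size_polyD _ _)) // geq_max.
  by apply/andP; split; [apply: (@size_polyM_le _ _ _ 1)
                       | apply: (@size_polyM_le _ _ _ 2)].
rewrite (leq_trans (size_polyD _ _)) // geq_max ht /=.
exact: (@size_polyM_le _ _ _ 1).
Qed.

Lemma expR_le_cayley (R : realType) (r : R) :
  1 < r -> expR r^-1 <= (r + 1) / (r - 1).
Proof.
move=> r1; have r0 : 0 < r by lra.
(* This is 1 + y <= exp y at y = - 2 / (r + 1); taking inverses bounds exp (2 / (r + 1)). *)
have h : (r - 1) / (r + 1) <= expR (- (2 / (r + 1))).
  apply: le_trans (expR_ge1Dx _); rewrite le_eqVlt; apply/orP; left.
  by apply/eqP; field; lra.
have hr : r^-1 <= 2 / (r + 1).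
  by rewrite ler_pdivlMr ?ler_pdivrMl //; [nra | lra].
apply: le_trans (_ : expR (2 / (r + 1)) <= _); first by rewrite ler_expR.
by rewrite -lef_pV2 ?posrE ?expR_gt0 ?divr_gt0 -?expRN ?invf_div //; lra.
Qed.

Theorem theorem3 (R : realType) :
  exists M : R, 0 < M /\
    forall kappa delta : R, 2 <= kappa -> 0 < delta < 1 / 2 ->
      exists p : {poly R},
        (size p).-1%:R <= M * Num.sqrt kappa * ln (kappa / delta) /\
        forall x : R, 1 <= x <= kappa -> `|p.[x] - x^-1| <= delta / kappa.
Proof.
(* Rounding [2 * r * L] up costs at most 1, which is at most [2 * r * L] because [1 < r] and
   [1 / 2 <= L]; hence 4. *)
exists 4; split=> // kappa delta hk /andP[d0 d1].
set r := Num.sqrt kappa; set L := ln (kappa / delta).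
have k0 : 0 < kappa by lra.
have rr : r ^+ 2 = kappa by rewrite sqr_sqrtr // ltW.
have r0 : 0 <= r := sqrtr_ge0 _.
have r1 : 1 < r by nra.
have q4 : 4 <= kappa / delta by rewrite ler_pdivlMr //; lra.
have q0 : 0 < kappa / delta by lra.
have eL : expR L = kappa / delta by rewrite lnK.
have L12 : 1 / 2 <= L.
  have := expR_ge1Dx (- L); rewrite expRN eL.
  have : (kappa / delta)^-1 <= 4^-1 by rewrite lef_pV2 ?posrE.
  lra.
have rL0 : 0 <= 2 * r * L by nra.
pose n := (Num.trunc (2 * r * L)).+1.
have nlt : 2 * r * L < n%:R by apply: truncnS_gt.
have nle : n%:R <= 4 * r * L.
  by have := truncn_le (2 * r * L); rewrite rL0 /n -natr1 => ?; nra.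
(* [l] reverses orientation, sending 1 to 1 and [kappa] to -1, so that its value [z] at 0 exceeds
   1. *)
pose z := (kappa + 1) / (kappa - 1).
pose l : {poly R} := z%:P - (2 / (kappa - 1)) *: 'X.
pose t := (chebyshev z n).1.
have lE x : l.[x] = z - 2 / (kappa - 1) * x by rewrite /l !hornerE.
have ht : 2 * (kappa / delta) <= 2 * t.
  (* A square root of [z ^+ 2 - 1], since (kappa + 1)^2 - (kappa - 1)^2 = 4 kappa = (2 r)^2. *)
  pose s := 2 * r / (kappa - 1).
  have hs : s ^+ 2 = z ^+ 2 - 1.
    by rewrite /s /z -rr; field; nra.
  have sz : s <= z by rewrite ler_pM2r ?invr_gt0; nra.
  apply: le_trans (chebyshev_ge n hs sz).
  have -> : z + s = (r + 1) / (r - 1) by rewrite /s /z -rr; field; nra.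
  (* exp (2 L) is the square of [kappa / delta], and one of the two factors absorbs the constant
     2. *)
  apply: le_trans (_ : expR (L *+ 2) <= _).
    by rewrite mulr2n expRD eL ler_pM2r //; lra.
  apply: le_trans (_ : expR r^-1 ^+ n <= _).
    rewrite -expRM_natr ler_expR ler_pdivlMl; last by lra.
    by rewrite -mulr_natr; lra.
  by rewrite lerXn2r ?nnegrE ?expR_ge0 ?expR_le_cayley // divr_ge0; lra.
have t0 : 0 < t by lra.
pose q := 1 - t^-1 *: (chebyshev l n).1.
have hq x : q.[x] = 1 - t^-1 * (chebyshev l.[x] n).1.
  by rewrite /q !hornerE horner_chebyshev lE.
have [p qE] : exists p, q = p * ('X - 0%:P).
  apply/factor_theorem/rootP; rewrite hq lE mulr0 subr0 -/t mulVf ?subrr //.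
  by rewrite gt_eqF.
rewrite subr0 in qE.
exists p; split.
  have hl : (size l <= 2)%N.
    rewrite (leq_trans (size_polyD _ _)) // geq_max size_polyN.
    rewrite (leq_trans (size_polyC_leq1 _)) //.
    by rewrite (leq_trans (size_scale_leq _ _)) // size_polyX.
  have /andP[hT _] := size_chebyshev n hl.
  have sq : (size q <= n.+1)%N.
    rewrite (leq_trans (size_polyD _ _)) // geq_max size_poly1 size_polyN.
    by rewrite (leq_trans (size_scale_leq _ _)).
  apply: le_trans nle; rewrite ler_nat.
  (* Multiplication by ['X] raises the size by one only for nonzero [p]. *)
  have [->|p0] := eqVneq p 0; first by rewrite size_poly0.
  by move: sq; rewrite qE size_mulX // ltnS => /(leq_trans (leq_pred _)).
move=> x /andP[x1 xk].
have x0 : 0 < x by lra.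
have -> : p.[x] - x^-1 = - (t^-1 * (chebyshev l.[x] n).1 / x).
  have : q.[x] = p.[x] * x by rewrite qE !hornerE.
  rewrite hq => h; apply: (mulIf (lt0r_neq0 x0)).
  by rewrite mulrBl -h; field; rewrite !gt_eqF.
have hlx : -1 <= l.[x] <= 1.
  have -> : l.[x] = (kappa + 1 - 2 * x) / (kappa - 1).
    by rewrite lE /z; field; lra.
  by rewrite ler_pdivlMr ?ler_pdivrMr; lra.
rewrite normrN !normrM !normfV (gtr0_norm t0) (gtr0_norm x0) -[leRHS]invf_div.
(* The factor 1 / x in the error is at most 1 because [1 <= x]. *)
apply: le_trans (_ : t^-1 <= _); last by rewrite lef_pV2 ?posrE //; lra.
rewrite ler_pdivrMr // ler_pM2l ?invr_gt0 //.
exact: le_trans (chebyshev_norm_le1 n hlx) x1.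
Qed.
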